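(* Let $C\subseteq\mathbb{R}^{(\mathbb{N})}$ be a $\mathrm{Sym}$-equivariantly finitely generated rational cone. Then $M=C\cap\mathbb{Z}^{(\mathbb{N})}$ is a $\mathrm{Sym}$-equivariantly finitely generated normal monoid.
   Context: $\mathbb{R}^{(\mathbb{N})}$ (resp. $\mathbb{Z}^{(\mathbb{N})}$) denotes the set of real (resp. integer) sequences $(u_i)_{i\in\mathbb{N}}$ with only finitely many nonzero entries. $\mathrm{Sym}$ is the group of permutations of $\mathbb{N}$ fixing all but finitely many elements, acting by permuting coordinates: $\sigma(u)=\sum_iu_ie_{\sigma(i)}$. $\mathrm{cone}(A)$ is the set of finite nonnegative real combinations of elements of $A$. A cone $C$ is $\mathrm{Sym}$-equivariantly finitely generated and rational if $C=\mathrm{cone}(\{\sigma(a)\mid\sigma\in\mathrm{Sym},a\in A\})$ for some finite $A\subseteq\mathbb{Z}^{(\mathbb{N})}$. A monoid $M\subseteq\mathbb{Z}^{(\mathbb{N})}$ is $\mathrm{Sym}$-equivariantly finitely generated if there is a finite $B$ such that $M$ is the set of finite nonnegative integer combinations of elements $\sigma(b)$, $\sigma\in\mathrm{Sym}$, $b\in B$. $M$ is normal if whenever $u\in\mathbb{Z}^{(\mathbb{N})}$ and $ku\in M$ for some positive integer $k$, then $u\in M$. *)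

(* Defs.v *)
From mathcomp Require Export all_boot all_order all_algebra.
From mathcomp Require Export finmap monalg.
From mathcomp Require Export boolp classical_sets functions cardinality reals.

Set Implicit Arguments.
Unset Strict Implicit.
Unset Printing Implicit Defensive.

Import GRing.Theory.

Local Open Scope classical_set_scope.
Local Open Scope ring_scope.

(* [{malg G[nat]}] is the module of finitely supported maps [nat -> G], so
   [{malg R[nat]}] is R^(N) and [{malg int[nat]}] is Z^(N); [<< c *g i >>] is
   [c e_i]. The multiplication of [malg] plays no role here. *)

Definition Sym : set (nat -> nat) :=
  [set s | bijective s /\ finite_set [set i | s i <> i]].

Definition sym_act (G : zmodType) (s : nat -> nat) (u : {malg G[nat]}) :
    {malg G[nat]} :=
  \sum_(i <- msupp u) << u@_i *g s i >>.

Definition sym_orbit (G : zmodType) (A : set {malg G[nat]}) :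
    set {malg G[nat]} :=
  [set v | exists s a, [/\ Sym s, A a & v = sym_act s a]].

Definition int_to_real (R : realType) (u : {malg int[nat]}) : {malg R[nat]} :=
  \sum_(i <- msupp u) << (u@_i)%:~R *g i >>.

Definition cone (R : realType) (A : set {malg R[nat]}) : set {malg R[nat]} :=
  [set u | exists (n : nat) (c : 'I_n -> R) (v : 'I_n -> {malg R[nat]}),
     [/\ forall i, 0 <= c i, forall i, A (v i)
       & u = \sum_(i < n) c i *: v i]].

Definition monoid_span (A : set {malg int[nat]}) : set {malg int[nat]} :=
  [set u | exists (n : nat) (c : 'I_n -> nat) (v : 'I_n -> {malg int[nat]}),
     (forall i, A (v i)) /\ u = \sum_(i < n) v i *+ c i].

Definition sym_fg_rational_cone (R : realType) (C : set {malg R[nat]}) : Prop :=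
  exists A : set {malg int[nat]},
    finite_set A /\ C = cone (sym_orbit (int_to_real R @` A)).

Definition is_monoid (M : set {malg int[nat]}) : Prop :=
  M 0 /\ forall u v, M u -> M v -> M (u + v).

Definition sym_fg_monoid (M : set {malg int[nat]}) : Prop :=
  exists B : set {malg int[nat]}, finite_set B /\ M = monoid_span (sym_orbit B).

Definition normal_monoid (M : set {malg int[nat]}) : Prop :=
  forall (u : {malg int[nat]}) (k : nat), (0 < k)%N -> M (u *+ k) -> M u.

Definition lattice_points (R : realType) (C : set {malg R[nat]}) :
    set {malg int[nat]} :=
  [set u | C (int_to_real R u)].

Lemma mcoeff_sym_act (G : zmodType) (s : nat -> nat) (u : {malg G[nat]}) i :
  injective s -> (sym_act s u)@_(s i) = u@_i.
Proof.
move=> s_inj; rewrite /sym_act raddf_sum /=.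
have -> : u@_i = \sum_(j <- msupp u) << u@_j *g j >>@_i.
  by rewrite [in LHS](monalgE u) raddf_sum.
by apply: eq_bigr => j _; rewrite !mcoeffU (inj_eq s_inj).
Qed.

Lemma mcoeff_int_to_real (R : realType) (u : {malg int[nat]}) i :
  (int_to_real R u)@_i = (u@_i)%:~R.
Proof.
rewrite /int_to_real raddf_sum /= [in RHS](monalgE u) !raddf_sum /=.
by apply: eq_bigr => j _; rewrite !mcoeffU; case: eqP.
Qed.

(* Main.v *)
(* Write O for the Sym-orbit of the generators, all with at most n nonzero entries,
   C = cone O and M for the lattice points of C.
   - Convexity and symmetry make C closed under transfers x - d e_a + d e_b with
     0 <= d <= x_a - x_b, hence (Rado) under majorization inside any finite block of
     coordinates.
   - The monoid N generated by the elements of M of l1-norm at most K is closed under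
     unit transfers: if (g + h)_a > (g + h)_b then g_a > g_b or h_a > h_b, and a unit
     transfer does not increase the l1-norm.
   - If u in M has at least 2n positive (or 2n negative) entries, then u is a unit
     transfer of some v in M with the same l1-norm and a larger sum of squares. By
     induction it remains to put into N the u in M with at most 4n nonzero entries.
   - Such a u, supported in a window of 4n coordinates, is a nonnegative combination of
     generators supported in that window and n further coordinates: move the generators
     into these coordinates and average there. These generators are finitely many, so
     Gordan's argument (split off the integral parts of the coefficients) leaves a
     remainder in M of bounded norm. *)

Require Import Defs.
From mathcomp Require Import lra zify.

Set Implicit Arguments.
Unset Strict Implicit.
Unset Printing Implicit Defensive.

Import Order.TTheory GRing.Theory Num.Theory.

Local Open Scope classical_set_scope.
Local Open Scope ring_scope.

(** * Transpositions and the permutation action on coordinates *)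

Definition swap (i j k : nat) : nat :=
  if k == i then j else if k == j then i else k.

Lemma swapK i j : involutive (swap i j).
Proof.
move=> k; rewrite /swap.
have [->|ki] := eqVneq k i; first by rewrite eqxx; case: eqVneq => // ->.
by have [->|/negbTE ->] := eqVneq k j; rewrite ?eqxx ?(negbTE ki).
Qed.

Lemma swap_neq i j k : k != i -> k != j -> swap i j k = k.
Proof. by rewrite /swap => /negbTE -> /negbTE ->. Qed.

Lemma Sym_swap i j : Sym (swap i j).
Proof.
split; first by exists (swap i j); apply: swapK.
apply: (sub_finite_set _ (finite_seq [:: i; j])) => k /= ki; rewrite !inE.
by apply: contra_notT ki; rewrite negb_or => /andP[]; apply: swap_neq.
Qed.

Lemma Sym_comp s t : Sym s -> Sym t -> Sym (s \o t).
Proof.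
move=> [sb sf] [tb tf]; split; first exact: bij_comp.
have: finite_set ([set i | t i <> i] `|` [set i | s i <> i]) by rewrite finite_setU.
apply: sub_finite_set => i /= si; case: (pselect (t i = i)) => ti; last by left.
by right; rewrite /= -{1}ti.
Qed.

Section Action.
Variable G : zmodType.
Implicit Types (x y : {malg G[nat]}) (s t : nat -> nat).

Lemma mcoeff_sym_act_can s t x k :
  cancel s t -> cancel t s -> (sym_act s x)@_k = x@_(t k).
Proof. by move=> st ts; rewrite -{1}(ts k) mcoeff_sym_act //; apply: can_inj st. Qed.

Lemma mcoeff_swap i j x k : (sym_act (swap i j) x)@_k = x@_(swap i j k).
Proof. by apply: mcoeff_sym_act_can; apply: swapK. Qed.

Lemma sym_act_swapK i j : involutive (@sym_act G (swap i j)).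
Proof. by move=> x; apply/malgP => k; rewrite !mcoeff_swap swapK. Qed.

Lemma sym_act_comp s t x :
  Sym s -> Sym t -> sym_act s (sym_act t x) = sym_act (s \o t) x.
Proof.
move=> [sb _] [tb _]; apply/malgP => k.
case: (sb) (tb) => s' ss' s's [t' tt' t't].
rewrite (mcoeff_sym_act_can _ _ ss' s's) (mcoeff_sym_act_can _ _ tt' t't).
by rewrite (@mcoeff_sym_act_can _ (t' \o s')) //; apply: can_comp.
Qed.

Lemma sym_act_id x : sym_act id x = x.
Proof. by rewrite /sym_act -monalgE. Qed.

Definition shift (d : G) i j x := x + << d *g j >> - << d *g i >>.

Lemma mcoeff_shift d i j x k :
  (shift d i j x)@_k = x@_k + d *+ (j == k) - d *+ (i == k).
Proof. by rewrite /shift mcoeffB mcoeffD !mcoeffU. Qed.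

Definition psum m x := \sum_(k < m) x@_(k : nat).

Lemma psumS m x : psum m.+1 x = psum m x + x@_m.
Proof. by rewrite /psum big_ord_recr. Qed.

Lemma psumD m x y : psum m (x + y) = psum m x + psum m y.
Proof. by rewrite /psum -big_split; apply: eq_bigr => k _; rewrite mcoeffD. Qed.

Lemma psumN m x : psum m (- x) = - psum m x.
Proof. by rewrite /psum -sumrN; apply: eq_bigr => k _; rewrite mcoeffN. Qed.

Lemma psumU (d : G) i m : psum m << d *g i >> = d *+ (i < m)%N.
Proof.
elim: m => [|m IH]; first by rewrite /psum big_ord0.
rewrite psumS IH mcoeffU -mulrnDr ltnS.
by case: (ltngtP i m) => //= ->.
Qed.

Lemma psum_shift d i j x m :
  psum m (shift d i j x) = psum m x + d *+ (j < m)%N - d *+ (i < m)%N.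
Proof. by rewrite /shift !psumD psumN !psumU. Qed.

(** Views a transposition as the transfer of the full difference, so that its effect on partial sums
    is a case of [psum_shift]. *)
Lemma swap_shift i j x : sym_act (swap i j) x = shift (x@_i - x@_j) i j x.
Proof.
apply/malgP => k; rewrite mcoeff_swap mcoeff_shift /swap !(eq_sym _ k).
have [->|ki] := eqVneq k i.
  have [->|ij] := eqVneq i j; first by rewrite subrr !mul0rn subr0 addr0.
  by rewrite addr0 mulr1n opprB addrC subrK.
by case: eqVneq => [->|kj]; rewrite ?subr0 ?addr0 // addrC subrK.
Qed.

(** The bound [r] admits sets that are symmetric only in a prefix, such as the generators confined
    to a window. *)
Definition swap_closed r (D : set {malg G[nat]}) :=
  forall i j x, (i < r)%N -> (j < r)%N -> D x -> D (sym_act (swap i j) x).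

Definition supp_le n x :=
  exists2 t : seq nat, (size t <= n)%N & forall k, k \notin t -> x@_k = 0.

Lemma supp_le_swap n x i j : supp_le n x -> supp_le n (sym_act (swap i j) x).
Proof.
move=> [t tn t0]; exists [seq swap i j k | k <- t]; first by rewrite size_map.
move=> k kt; rewrite mcoeff_swap t0 //; apply: contraNN kt => kt.
by rewrite -(swapK i j k) map_f.
Qed.

(* The window [[a, a + w[] always has a free slot for a coordinate outside of
   it, because the support has at most [w] elements. *)
Lemma supp_to_window (D : set {malg G[nat]}) x a w (F : pred nat) :
    (forall r, swap_closed r D) -> D x -> supp_le w x ->
  exists2 y, D y & forall k, ~~ (a <= k < a + w)%N -> y@_k = if F k then x@_k else 0.
Proof.
move=> sD.
(* [s] lists the positions that may still have to be emptied; each step of the induction clears its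
   head. *)
pose bad x (s : seq nat) :=
  forall k, ~~ (a <= k < a + w)%N -> ~~ F k -> k \notin s -> x@_k = 0.
suff main (s : seq nat) : bad x s -> D x -> supp_le w x ->
    exists2 y, D y & forall k, ~~ (a <= k < a + w)%N -> y@_k = if F k then x@_k else 0.
  move=> Dx xw; apply: (main (msupp x : seq nat)) => // k _ _; exact: mcoeff_outdom.
elim: s x => [|k s IH] x bx Dx xw.
  by exists x => // k kw; case: ifPn => // Fk; apply: bx.
have [/orP kok|] := boolP ((a <= k < a + w)%N || F k || (x@_k == 0)).
  apply: IH => // l lw Fl ls; have [lk|lk] := eqVneq l k.
    by move: kok lw Fl; rewrite lk => -[/orP[->|->]|/eqP] //.
  by apply: bx; rewrite // inE negb_or lk.
rewrite !negb_or => /andP[/andP[kw Fk] xk].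
have [i iw xi] : exists2 i, (a <= i < a + w)%N & x@_i = 0.
  case: xw => t tw t0; apply: contrapT => nfree.
  suff: (size (k :: iota a w) <= size t)%N by rewrite /= size_iota; lia.
  apply: uniq_leq_size.
    by rewrite /= iota_uniq andbT mem_iota.
  move=> l; rewrite inE mem_iota => /orP[/eqP ->|lw].
    by apply: contraNT xk => /t0 ->.
  by apply: contra_notT nfree => /t0 ?; exists l.
have [|||y Dy yE] := IH (sym_act (swap i k) x).
- move=> l lw Fl ls; rewrite mcoeff_swap.
  have li : l != i by apply: contraNneq lw => ->.
  have [->|lk] := eqVneq l k; first by rewrite /swap eqxx; case: eqVneq => [->|].
  by rewrite swap_neq //; apply: bx; rewrite // inE negb_or lk.
- by apply: (sD (i + k).+1) => //; lia.
- exact: supp_le_swap.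
- exists y => // l lw; rewrite yE //; case: ifP => // Fl.
  by rewrite mcoeff_swap swap_neq //;
    [apply: contraNneq lw => -> | apply: contraNneq Fk => <-].
Qed.

End Action.

(** * Sorting and majorization *)

Section Sorting.
Variable G : realDomainType.

Definition sorted_upto r (x : {malg G[nat]}) :=
  forall k, (k.+1 < r)%N -> x@_k.+1 <= x@_k.

Lemma sorted_upto_le r x i j :
  sorted_upto r x -> (i <= j)%N -> (j < r)%N -> x@_j <= x@_i.
Proof.
move=> xs; elim: j => [|j IH]; first by rewrite leqn0 => /eqP ->.
rewrite leq_eqVlt => /orP[/eqP -> //|ij] jr.
by apply: le_trans (xs _ jr) (IH _ _); lia.
Qed.

(** Selection sort: the least of the first [r + 1] entries is swapped to the end and the rest is
    sorted by induction. Each swap moves a small value to the right, so no partial sum decreases. *)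
Lemma sort_mem r (D : set {malg G[nat]}) x : swap_closed r D -> D x ->
  exists y, [/\ D y, sorted_upto r y, forall k, (r <= k)%N -> y@_k = x@_k,
    forall m, psum m x <= psum m y &
    psum r y = psum r x].
Proof.
(* Lower bounds are carried along to compare the entry placed last with the sorted prefix. *)
move=> sD Dx; suff: exists y, [/\ D y, sorted_upto r y,
    forall k, (r <= k)%N -> y@_k = x@_k,
    forall m, psum m x <= psum m y &
    psum r y = psum r x /\
    forall c, (forall k, (k < r)%N -> c <= x@_k) -> forall k, (k < r)%N -> c <= y@_k].
  by move=> [y [? ? ? ? [? ?]]]; exists y.
elim: r x sD Dx => [|r IH] x sD Dx; first by exists x; split=> //; rewrite /psum !big_ord0.
have [j jr jmin] : exists2 j, (j <= r)%N & forall k, (k <= r)%N -> x@_j <= x@_k.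
  have [j _ jmin] := @Order.TotalTheory.arg_minP _ _ _ (ord0 : 'I_r.+1) xpredT
    (fun k : 'I_r.+1 => x@_(k : nat)) isT.
  by exists j => [|k kr]; [rewrite -ltnS | apply: (jmin (Ordinal (kr : (k < r.+1)%N)))].
pose x' := sym_act (swap j r) x.
have x'E : x' = shift (x@_j - x@_r) j r x by rewrite /x' swap_shift.
have x'r : x'@_r = x@_j.
  by rewrite mcoeff_swap /swap eqxx; case: eqVneq => // ->.
have x'D : D x' by apply: sD.
have x'lb c : (forall k, (k <= r)%N -> c <= x@_k) -> forall k, (k <= r)%N -> c <= x'@_k.
  move=> cx k kr; rewrite mcoeff_swap /swap.
  by case: ifP => _; [apply: cx | case: ifP => _; apply: cx].
have [|y [Dy ys yx' yge [yeq ylb]]] := IH x' _ x'D.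
  by move=> i k z ir kr; apply: sD; lia.
have yr : y@_r = x@_j by rewrite yx' // x'r.
have xyge m : psum m x <= psum m x'.
  rewrite x'E psum_shift.
  have := jmin r (leqnn r); have := jr.
  by case: (ltnP j m) => jm; case: (ltnP r m) => rm; rewrite ?mulr1n ?mulr0n; lra || lia.
have x'eq : psum r.+1 x' = psum r.+1 x.
  by rewrite x'E psum_shift !ltnS jr leqnn addrK.
exists y; split => //.
- move=> k; rewrite ltnS leq_eqVlt => /orP[/eqP kr|/ys//].
  rewrite kr yr; apply: ylb; last by rewrite -kr.
  by move=> l lr; apply: x'lb; rewrite // ltnW.
- move=> k rk; rewrite yx'; last exact: ltnW.
  by rewrite mcoeff_swap swap_neq //; lia.
- by move=> m; apply: le_trans (xyge m) (yge m).
- split; first by rewrite -x'eq !psumS yeq yx'.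
  move=> c cx k; rewrite ltnS leq_eqVlt => /orP[/eqP ->|kr].
    by rewrite yr; apply: cx.
  by apply: ylb => // l lr; apply: x'lb; rewrite // ltnW.
Qed.

(** Partial sums of a nonincreasing sequence are concave: the mean over [[i, m[] is at most the mean
    over [[i, k[]. Cross-multiplying avoids division and covers empty intervals. *)
Lemma sorted_sum_concave r (x : {malg G[nat]}) i k m : sorted_upto r x ->
    (i <= k)%N -> (k <= m)%N -> (m <= r)%N ->
  (psum m x - psum i x) *+ (k - i) <=
  (psum k x - psum i x) *+ (m - i).
Proof.
move=> xs ik km mr.
have sumE a b : (a <= b)%N ->
    psum b x - psum a x = \sum_(a <= l < b) x@_l.
  move=> ab; rewrite /psum -!(big_mkord xpredT (fun l => x@_l)).
  by rewrite (big_cat_nat (n := a)) //= addrAC subrr add0r.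
rewrite !sumE //; last exact: leq_trans km.
rewrite [in leLHS](big_cat_nat (n := k)) //= mulrnDl.
rewrite -[(m - i)%N](subnK (_ : k - i <= _)%N); last lia.
rewrite mulrnDr addrC lerD2r.
have [ki|ki] := eqVneq k i; first by rewrite ki subnn mulr0n big_geq // mul0rn.
have kr : (k.-1 < r)%N by lia.
(* [x_(k-1)] separates the entries on [[k, m[] from those on [[i, k[]. *)
apply: (@le_trans _ _ ((x@_k.-1 *+ (m - k)) *+ (k - i))).
  rewrite lerMn2r; apply/orP; right.
  rewrite -sumr_const_nat; apply: ler_sum_nat => l /andP[kl lm].
  by apply: (sorted_upto_le xs); lia.
rewrite -mulrnA mulnC mulrnA [(m - i - (k - i))%N](_ : _ = (m - k)%N); last lia.
rewrite lerMn2r; apply/orP; right.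
rewrite -sumr_const_nat; apply: ler_sum_nat => l /andP[kl lm].
by apply: (sorted_upto_le xs); lia.
Qed.

End Sorting.

Section Majorization.
Variable R : realFieldType.

Definition convex_set (D : set {malg R[nat]}) :=
  forall x y l, 0 <= l <= 1 -> D x -> D y -> D (x + l *: (y - x)).

(** The transfer is the point at fraction [d / (x_i - x_j)] of the segment from [x] to its image
    under the swap of [i] and [j]. *)
Lemma shift_mem r D (x : {malg R[nat]}) i j d : swap_closed r D -> convex_set D ->
    (i < r)%N -> (j < r)%N -> D x -> 0 <= d <= x@_i - x@_j ->
  D (shift d i j x).
Proof.
move=> sD cD ir jr Dx /andP[d0 dx].
have [d_eq0|dn0] := eqVneq d 0.
  by rewrite /shift d_eq0 !monalgU0 addr0 subr0.
have e0 : 0 < x@_i - x@_j by apply: lt_le_trans dx; rewrite lt_def dn0.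
rewrite (_ : shift d i j x = x + (d / (x@_i - x@_j)) *: (sym_act (swap i j) x - x)).
  by apply: cD => //; [rewrite divr_ge0 // ?ler_pdivrMr ?mul1r // ltW | apply: sD].
apply/malgP => k; rewrite mcoeff_shift swap_shift mcoeffD mcoeffZ mcoeffB mcoeff_shift.
have -> : x@_k + (x@_i - x@_j) *+ (j == k) - (x@_i - x@_j) *+ (i == k) - x@_k =
    (x@_i - x@_j) * ((j == k)%:R - (i == k)%:R).
  by rewrite mulrBr !mulr_natr addrAC [x@_k + _]addrC addrK.
by rewrite mulrA divfK ?(gt_eqF e0) // mulrBr !mulr_natr addrA.
Qed.

(* Rado's theorem: [x] is reached from [b] by transfers, each of which makes one
   more coordinate agree. *)
Lemma majorized_mem r D (x b : {malg R[nat]}) : swap_closed r D -> convex_set D ->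
    D b -> sorted_upto r x -> (forall k, (r <= k)%N -> x@_k = b@_k) ->
    (forall m, (m <= r)%N -> psum m x <= psum m b) ->
    psum r x = psum r b ->
  D x.
Proof.
move=> sD cD Db xs.
have [d] := ubnP #|[pred k : 'I_r | x@_(k : nat) != b@_(k : nat)]|.
elim: d b Db => // d IH b Db; rewrite ltnS => bd xb xle xeq.
have [/forallP eqxb|] := boolP [forall k : 'I_r, x@_(k : nat) == b@_(k : nat)].
  suff -> : x = b by [].
  apply/malgP => k; case: (ltnP k r) => kr; last exact: xb.
  exact/eqP/(eqxb (Ordinal kr)).
rewrite negb_forall => /existsP [i0 i0P].
have exi : exists i, (i < r)%N && (x@_i != b@_i) by exists i0; rewrite ltn_ord i0P.
case: (ex_minnP exi) => i /andP[ir xi] imin.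
have ilt l : (l < i)%N -> x@_l = b@_l.
  move=> li; apply/eqP; apply: contraTT li => xl; rewrite -leqNgt imin // xl andbT.
  by case: ltnP => // /xb /eqP; rewrite (negbTE xl).
(* The partial sums agree up to the first difference [i], so the next one decides the sign. *)
have {}xi : x@_i < b@_i.
  rewrite lt_neqAle xi /=; have := xle i.+1 ir; rewrite !psumS.
  suff -> : psum i x = psum i b by rewrite lerD2l.
  by apply: eq_bigr => k _; apply: ilt.
(* The totals agree, so the deficit of [x] at [i] is made up by an excess elsewhere. *)
have exk : exists k, (k < r)%N && (b@_k < x@_k).
  apply: contrapT => nk; have : psum r x < psum r b.
    rewrite /psum (bigD1 (Ordinal ir)) //= [ltRHS](bigD1 (Ordinal ir)) //=.
    apply: ltr_leD => //; apply: ler_sum => k _.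
    by rewrite leNgt; apply/negP => bx; apply: nk; exists k; rewrite ltn_ord.
  by rewrite xeq ltxx.
case: (ex_minnP exk) => k /andP[kr xk] kmin.
have klt l : (l < k)%N -> x@_l <= b@_l.
  move=> lk; rewrite leNgt; apply/negP => xl.
  by have := kmin l; rewrite xl (ltn_trans lk kr) => /(_ isT); lia.
have ik : (i < k)%N.
  rewrite ltnNge leq_eqVlt; apply/negP => /orP[/eqP ki|ki].
    by move: xk xi; rewrite ki; lra.
  by move: xk; rewrite (ilt _ ki) ltxx.
have xki : x@_k <= x@_i by apply: (sorted_upto_le xs) => //; apply: ltnW.
(* The largest transfer from [i] to [k] that overshoots neither target; it makes one of the two
   entries agree. As [x_k <= x_i], it is at most [b_i - b_k]. *)
pose e := Num.min (b@_i - x@_i) (x@_k - b@_k).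
have e0 : 0 < e by rewrite lt_min !subr_gt0 xi xk.
have ei : e <= b@_i - x@_i by rewrite ge_min lexx.
have ek : e <= x@_k - b@_k by rewrite ge_min lexx orbT.
have neik : (i == k) = false by lia.
have neki : (k == i) = false by lia.
apply: (IH (shift e i k b)).
- by apply: (shift_mem (r := r)) => //; apply/andP; split; lra.
- apply: leq_trans (proper_card _) bd; apply/properP; split.
    apply/fintype.subsetP => l; rewrite !inE mcoeff_shift.
    have [<-|kl] := eqVneq k l; first by rewrite (gt_eqF xk).
    have [<-|il] := eqVneq i l; first by rewrite (lt_eqF xi).
    by rewrite addr0 subr0.
  case: (leP (b@_i - x@_i) (x@_k - b@_k)) => ie.
    exists (Ordinal ir); rewrite !inE /=; first by rewrite (lt_eqF xi).
    rewrite negbK mcoeff_shift neki eqxx.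
    by apply/eqP; rewrite /e (min_idPl ie) mulr0n mulr1n; lra.
  exists (Ordinal kr); rewrite !inE /=; first by rewrite (gt_eqF xk).
  rewrite negbK mcoeff_shift neik eqxx.
  by apply/eqP; rewrite /e (min_idPr (ltW ie)) mulr0n mulr1n; lra.
- move=> l rl; rewrite mcoeff_shift xb //.
  have -> : (k == l) = false by lia.
  have -> : (i == l) = false by lia.
  by rewrite !mulr0n addr0 subr0.
- move=> m mr; rewrite psum_shift; case: (ltnP k m) => km.
    by rewrite (ltn_trans ik km) mulr1n addrK xle.
  case: (ltnP i m) => im; last by rewrite !mulr0n addr0 subr0 xle.
  (* For [i < m <= k] the comparison is termwise, since [x] does not exceed [b] before [k]. *)
  have := psum_shift e i k b m; rewrite im ltnNge km /= => <-.
  apply: ler_sum => l _; rewrite mcoeff_shift.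
  have -> : (k == l) = false by have := ltn_ord l; lia.
  case: eqVneq => [<-|_]; first by rewrite mulr0n mulr1n; lra.
  by rewrite !mulr0n addr0 subr0 klt // (leq_trans (ltn_ord l)).
- by rewrite psum_shift ir kr addrK.
Qed.

End Majorization.

(** * Additivity of the action, and the embedding of integer vectors into real ones *)

Lemma sym_actD (G : zmodType) s (x y : {malg G[nat]}) : Sym s ->
  sym_act s (x + y) = sym_act s x + sym_act s y.
Proof.
move=> [[t st ts] _]; apply/malgP => k.
by rewrite !(mcoeffD, mcoeff_sym_act_can _ _ st ts).
Qed.

Lemma sym_actN (G : zmodType) s (x : {malg G[nat]}) : Sym s ->
  sym_act s (- x) = - sym_act s x.
Proof.
move=> [[t st ts] _]; apply/malgP => k.
by rewrite !(mcoeffN, mcoeff_sym_act_can _ _ st ts).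
Qed.

Lemma sym_act_shift (G : zmodType) a b (d : G) i j x :
  sym_act (swap a b) (shift d i j x) =
  shift d (swap a b i) (swap a b j) (sym_act (swap a b) x).
Proof.
apply/malgP => k; rewrite mcoeff_swap !mcoeff_shift mcoeff_swap.
by rewrite !(can2_eq (swapK a b) (swapK a b)).
Qed.

Lemma malg_bound (G : zmodType) (x : {malg G[nat]}) :
  exists N, forall k, (N <= k)%N -> x@_k = 0.
Proof.
exists (\max_(k <- msupp x) k).+1 => k Nk; apply: mcoeff_outdom.
apply: contraTN Nk => kx; rewrite -leqNgt.
by rewrite (big_rem k) //= leq_maxl.
Qed.

Lemma psum_tail (G : zmodType) (x y : {malg G[nat]}) n m : (n <= m)%N ->
    (forall k, (n <= k < m)%N -> y@_k = x@_k) ->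
  psum m y - psum n y = psum m x - psum n x.
Proof.
elim: m => [|m IH]; first by rewrite leqn0 => /eqP ->; rewrite !subrr.
rewrite leq_eqVlt => /orP[/eqP ->|nm] xy; first by rewrite !subrr.
have E : psum m y - psum n y = psum m x - psum n x.
  by apply: IH => // k /andP[nk km]; apply: xy; rewrite nk ltnW.
by rewrite !psumS addrAC E addrAC xy // -ltnS nm /=.
Qed.

Section IntToReal.
Variable R : realType.
Implicit Types u v : {malg int[nat]}.

Lemma int_to_realD u v : int_to_real R (u + v) = int_to_real R u + int_to_real R v.
Proof. by apply/malgP => k; rewrite mcoeffD !mcoeff_int_to_real mcoeffD intrD. Qed.

Lemma int_to_realN u : int_to_real R (- u) = - int_to_real R u.
Proof. by apply/malgP => k; rewrite mcoeffN !mcoeff_int_to_real mcoeffN intrN. Qed.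

Lemma int_to_real0 : int_to_real R 0 = 0.
Proof. by apply/malgP => k; rewrite mcoeff_int_to_real !mcoeff0. Qed.

Lemma int_to_realMn u k : int_to_real R (u *+ k) = k%:R *: int_to_real R u.
Proof.
by apply/malgP => i; rewrite mcoeffZ !mcoeff_int_to_real mcoeffMn rmorphMn mulr_natl.
Qed.

Lemma int_to_real_sym_act s u : Sym s ->
  int_to_real R (sym_act s u) = sym_act s (int_to_real R u).
Proof.
move=> [[t st ts] _]; apply/malgP => k.
by rewrite !(mcoeff_int_to_real, mcoeff_sym_act_can _ _ st ts).
Qed.

Lemma int_to_real_shift (d : int) i j u :
  int_to_real R (shift d i j u) = shift d%:~R i j (int_to_real R u).
Proof.
by apply/malgP => k; rewrite mcoeff_shift !mcoeff_int_to_real mcoeff_shift intrB intrD !rmorphMn.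
Qed.

Lemma psum_int_to_real m u : psum m (int_to_real R u) = (psum m u)%:~R.
Proof. by rewrite /psum rmorph_sum; apply: eq_bigr => k _; rewrite mcoeff_int_to_real. Qed.

End IntToReal.

(** * Cones over symmetric sets of generators *)

Section Cones.
Variable R : realType.
Implicit Types (A O : set {malg R[nat]}) (x y : {malg R[nat]}).

Lemma psumZ m (a : R) x : psum m (a *: x) = a * psum m x.
Proof. by rewrite /psum mulr_sumr; apply: eq_bigr => k _; rewrite mcoeffZ. Qed.

Lemma cone_ind A (P : {malg R[nat]} -> Prop) :
    P 0 -> (forall x y, P x -> P y -> P (x + y)) ->
    (forall a x, 0 <= a -> A x -> P (a *: x)) ->
  forall x, cone A x -> P x.
Proof.
move=> P0 PD PZ x [m [c [v [c0 vA ->]]]].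
by elim/big_ind: _ => // i _; apply: PZ.
Qed.

Lemma cone0 A : cone A 0.
Proof.
exists 0%N, (fun _ => 0), (fun _ => 0).
by split; [ | case | rewrite big_ord0].
Qed.

Lemma coneD A x y : cone A x -> cone A y -> cone A (x + y).
Proof.
move=> [m [c [v [c0 vA ->]]]] [p [d [w [d0 wA ->]]]].
exists (m + p)%N, (fun i => match fintype.split i with inl j => c j | inr j => d j end).
exists (fun i => match fintype.split i with inl j => v j | inr j => w j end).
split=> [i|i|]; try by case: (fintype.split i).
rewrite big_split_ord.
apply: f_equal2.
  apply: eq_bigr => i _ /=.
  by rewrite (unsplitK (inl i)).
apply: eq_bigr => i _ /=.
by rewrite (unsplitK (inr i)).
Qed.

Lemma coneZ A a x : 0 <= a -> cone A x -> cone A (a *: x).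
Proof.
move=> a0 [m [c [v [c0 vA ->]]]]; exists m, (fun i => a * c i), v; split => //.
  by move=> i; apply: mulr_ge0.
by rewrite scaler_sumr; apply: eq_bigr => i _; rewrite scalerA.
Qed.

Lemma subset_cone A : A `<=` cone A.
Proof.
move=> x Ax; exists 1%N, (fun _ => 1), (fun _ => x).
by split=> //; rewrite big_ord1 scale1r.
Qed.

Lemma cone_convex A : convex_set (cone A).
Proof.
move=> x y l /andP[l0 l1] Ax Ay.
rewrite (_ : _ + _ = (1 - l) *: x + l *: y).
  by apply: coneD; apply: coneZ; rewrite // subr_ge0.
by rewrite scalerBr scalerBl scale1r addrA addrAC.
Qed.

Lemma sym_actZ s (a : R) x : Sym s -> sym_act s (a *: x) = a *: sym_act s x.
Proof.
move=> [[t st ts] _]; apply/malgP => k.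
by rewrite mcoeffZ !(mcoeff_sym_act_can _ _ st ts) mcoeffZ.
Qed.

Lemma cone_sym_act A s : Sym s -> (forall x, A x -> A (sym_act s x)) ->
  forall x, cone A x -> cone A (sym_act s x).
Proof.
move=> Ss sA; apply: cone_ind => [|x y|a x a0 Ax].
- rewrite (_ : sym_act s 0 = 0); first exact: cone0.
  by rewrite /sym_act msupp0 big_nil.
- by rewrite sym_actD //; apply: coneD.
- by rewrite sym_actZ //; apply: coneZ => //; apply/subset_cone/sA.
Qed.

Lemma cone_swap_closed r A : swap_closed r A -> swap_closed r (cone A).
Proof.
move=> sA i j x ir jr; apply: cone_sym_act (Sym_swap i j) _ _ => y.
exact: sA.
Qed.

Lemma cone_oppr A x : cone A x -> cone [set - y | y in A] (- x).
Proof.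
move: x; apply: cone_ind => [|x y|a x a0 Ax]; first by rewrite oppr0; apply: cone0.
  by rewrite opprD; apply: coneD.
by rewrite -scalerN; apply: coneZ => //; apply: subset_cone; exists x.
Qed.

Variables (O : set {malg R[nat]}) (n : nat).
Hypothesis n_gt0 : (0 < n)%N.
Hypothesis sO : forall r, swap_closed r O.
Hypothesis nO : forall x, O x -> supp_le n x.

(* The first [n] coordinates serve as a room into which every generator can be
   moved; the moved combination has sum zero there, hence majorizes zero. *)
Lemma cone_window L x : (n <= L)%N -> cone O x ->
    (forall k, (k < n)%N -> x@_k = 0) -> (forall k, (L <= k)%N -> x@_k = 0) ->
  cone [set y | O y /\ forall k, (L <= k)%N -> y@_k = 0] x.
Proof.
set OL := [set y | _]; move=> nL Ox x0 xL.
have sOL : swap_closed n OL.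
  move=> i j y ir jr [Oy yL]; split; first exact: sO ir jr _.
  by move=> k Lk; rewrite mcoeff_swap swap_neq ?yL //; lia.
(* [y] is the combination after moving: it keeps the coordinates in [[n, L[] and the total sum,
   expressed by the partial sums from some index on. *)
have: exists y, [/\ cone OL y, forall k, (n <= k < L)%N -> y@_k = x@_k &
    exists N, forall m, (N <= m)%N -> psum m y = psum m x].
  move: x Ox {x0 xL}.
  apply: cone_ind => [|x1 x2|a x a0 Ox].
  - by exists 0; split=> //; [apply: cone0 | exists 0%N].
  - move=> [y1 [Cy1 y1E [N1 y1N]]] [y2 [Cy2 y2E [N2 y2N]]].
    exists (y1 + y2); split; first exact: coneD.
      by move=> k kL; rewrite !mcoeffD y1E // y2E.
    exists (N1 + N2)%N => m Nm.
    by rewrite !psumD y1N ?y2N //; lia.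
  - pose D := [set y | O y /\ exists N, forall m, (N <= m)%N -> psum m y = psum m x].
    have sD r : swap_closed r D.
      move=> i j y ir jr [Oy [N yN]]; split; first exact: sO ir jr _.
      exists (N + i.+1 + j.+1)%N => m Nm; rewrite swap_shift psum_shift yN; last lia.
      have -> : (i < m)%N by lia.
      have -> : (j < m)%N by lia.
      by rewrite addrK.
    have Dx : D x by split=> //; exists 0%N.
    have [y [Oy [N yN]] yE] :=
      supp_to_window 0 (fun k => n <= k < L)%N sD Dx (nO Ox).
    exists (a *: y); split.
    + apply: coneZ => //; apply: subset_cone; split=> // k Lk.
      rewrite yE; last lia.
      by have -> : (n <= k < L)%N = false by lia.
    + move=> k kL; rewrite !mcoeffZ yE; last lia.
      by rewrite kL.
    + by exists N => m Nm; rewrite !psumZ yN.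
move=> [y [Cy yE [N yN]]].
have yL k : (L <= k)%N -> y@_k = 0.
  move=> Lk; move: y Cy {yE yN}.
  apply: cone_ind => [|y1 y2 E1 E2|a y a0 [_ yL]]; rewrite ?mcoeff0 //.
    by rewrite mcoeffD E1 E2 addr0.
  by rewrite mcoeffZ yL // mulr0.
have yEx k : (n <= k)%N -> y@_k = x@_k.
  by move=> nk; case: (ltnP k L) => kL; [apply: yE; rewrite nk | rewrite yL // xL].
have px m : (m <= n)%N -> psum m x = 0.
  by move=> mn; apply: big1 => k _; apply: x0; apply: leq_trans mn.
have pyn : psum n y = 0.
  have := psum_tail (leq_addl N n) (fun k kn => yEx k (proj1 (andP kn))).
  rewrite yN ?leq_addr // (px n) // subr0 => /eqP.
  by rewrite -subr_eq0 addrAC subrr add0r oppr_eq0 => /eqP.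
have sC := cone_swap_closed sOL.
have [b [Cb bs bE bge beq]] := sort_mem sC Cy.
apply: (majorized_mem (r := n) (b := b)) => //; first exact: cone_convex.
- by move=> k kn; rewrite !x0 //; apply: ltnW.
- by move=> k nk; rewrite bE // yEx.
- move=> m mn; rewrite px //.
  (* The first [n] entries of [b] have sum zero, so concavity makes the earlier partial sums
     nonnegative. *)
  have := sorted_sum_concave bs (leq0n m) mn (leqnn n).
  rewrite beq pyn [psum 0 b]big_ord0 !subn0 !subr0 mul0rn.
  by rewrite pmulrn_lge0.
- by rewrite px // beq.
Qed.

(** Each generator of a combination is sorted separately, rather than the vector itself. A sorted
    generator has its positive entries in front, at most [n] of them, and all the listed properties
    survive nonnegative combinations. *)
Lemma cone_sorted r x : cone O x ->
  exists b, [/\ cone O b, sorted_upto r b, forall k, (r <= k)%N -> b@_k = x@_k,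
    forall k, (n <= k < r)%N -> b@_k <= 0 &
    (forall m, psum m x <= psum m b) /\ psum r b = psum r x].
Proof.
move: x; apply: cone_ind => [|x1 x2|a x a0 Ox].
- exists 0; split=> //; first exact: cone0.
  + by move=> k _; rewrite !mcoeff0.
  + by move=> k _; rewrite mcoeff0.
- move=> [b1 [C1 s1 e1 n1 [m1 p1]]] [b2 [C2 s2 e2 n2 [m2 p2]]].
  exists (b1 + b2); split; first exact: coneD.
  + by move=> k kr; rewrite !mcoeffD lerD ?s1 ?s2.
  + by move=> k kr; rewrite !mcoeffD e1 ?e2.
  + by move=> k kr; rewrite mcoeffD -[leRHS]addr0 lerD ?n1 ?n2.
  + by split=> [m|]; rewrite !psumD ?lerD ?m1 ?m2 // p1 p2.
- have [b [Ob s e m p]] := sort_mem (@sO r) Ox.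
  exists (a *: b); split.
  + by apply: coneZ => //; apply: subset_cone.
  + by move=> k kr; rewrite !mcoeffZ ler_wpM2l // s.
  + by move=> k kr; rewrite !mcoeffZ e.
  + move=> k /andP[nk kr]; rewrite mcoeffZ mulr_ge0_le0 //.
    rewrite leNgt; apply/negP => bk; have [t tn t0] := nO Ob.
    suff: (size (iota 0 k.+1) <= size t)%N by rewrite size_iota; lia.
    apply: uniq_leq_size; first exact: iota_uniq.
    move=> l; rewrite mem_iota /= add0n ltnS => lk.
    apply: contraTT bk => /t0 bl; rewrite -leNgt -bl.
    exact: (sorted_upto_le s).
  + by split=> [q|]; rewrite !psumZ ?ler_wpM2l ?m ?p.
Qed.

(* With [c = u_(n-1)] and [i] the first index of value [c], a unit is moved from
   the last positive entry to [i]. Sorting the generators of [u] gives [b] in the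
   cone whose partial sums dominate those of [u]; at [n] the slack is at least
   [r - n >= n], and concavity leaves a slack of at least one on all of [[i+1, n]]. *)
Lemma cone_spread_sorted r (u : {malg int[nat]}) :
    cone O (int_to_real R u) -> sorted_upto r u ->
    (forall k, (k < r)%N -> 0 < u@_k) -> (n.*2 <= r)%N ->
  exists2 i, (i < n)%N & cone O (int_to_real R (shift 1 r.-1 i u)).
Proof.
move=> Cu us u0 nr.
have [b [Cb bs bE bneg [bge beq]]] := cone_sorted r Cu.
have exi : exists i, u@_i == u@_n.-1 by exists n.-1.
case: (ex_minnP exi) => i /eqP ui imin.
have iN : (i <= n.-1)%N by apply: imin.
have lti : (i < n)%N by lia.
exists i => //.
have uc k : (i <= k < n)%N -> u@_k = u@_i.
  move=> ikn; apply/eqP; rewrite eq_le (sorted_upto_le us) //=; try lia.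
  by rewrite ui (sorted_upto_le us); lia.
have psumc m : (i <= m <= n)%N -> psum m u = psum i u + u@_i *+ (m - i).
  elim: m => [|m IH]; first by case/andP; rewrite leqn0 => /eqP -> _; rewrite subnn addr0.
  case/andP; rewrite leq_eqVlt => /orP[/eqP -> _|im mn]; first by rewrite subnn addr0.
  by rewrite psumS IH ?uc ?subSn ?mulrSr ?addrA //; lia.
have psumge m : (m <= r)%N -> psum m u + (r - m)%:R <= psum r u.
  have [p] := ubnP (r - m)%N; elim: p m => // p IH m mp; rewrite leq_eqVlt.
  case/orP => [/eqP ->|mr]; first by rewrite subnn addr0.
  have := IH m.+1; rewrite psumS; have := u0 m mr.
  have -> : (r - m = (r - m.+1).+1)%N by lia.
  rewrite mulrSr => um /(_ _ mr) E; have {E} := E ltac:(lia); lia.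
have bmono m : (n <= m <= r)%N -> psum r b <= psum m b.
  have [p] := ubnP (r - m)%N; elim: p m => // p IH m mp /andP[nm]; rewrite leq_eqVlt.
  case/orP => [/eqP -> //|mr].
  apply: le_trans (IH m.+1 _ _) _; try lia.
  by rewrite psumS gerDl bneg // nm.
rewrite int_to_real_shift /=.
apply: (majorized_mem (r := r) (b := b)) => //.
- exact: cone_swap_closed.
- exact: cone_convex.
- rewrite -int_to_real_shift => k kr; rewrite !mcoeff_int_to_real ler_int !mcoeff_shift.
  have -> : (r.-1 == k) = false by lia.
  (* Raising the entry at [i] could spoil the order only against [i - 1], where minimality of [i]
     gives a strict descent. *)
  have := us k kr; have [ik|ik] := eqVneq i k.+1; last first.
    by case: (i == k); case: (r.-1 == k.+1); rewrite ?mulr1n ?mulr0n => uk; lra.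
  have uk1 : u@_k != u@_n.-1 by apply/negP => /imin; lia.
  move=> uk; have {uk1}uk : u@_k.+1 + 1 <= u@_k.
    by rewrite lezD1 lt_neqAle uk andbT -ik ui eq_sym.
  by case: (i == k); case: (r.-1 == k.+1); rewrite ?mulr1n ?mulr0n; lra.
- move=> k rk; rewrite mcoeff_shift bE //.
  have -> : (r.-1 == k) = false by lia.
  have -> : (i == k) = false by lia.
  by rewrite addr0 subr0.
- move=> m mr; rewrite psum_shift.
  case: (ltnP i m) => im; last first.
    have -> : (r.-1 < m)%N = false by lia.
    by rewrite addr0 subr0 bge.
  have [->|mneq] := eqVneq m r.
    have -> : (r.-1 < r)%N by lia.
    by rewrite addrK -beq.
  have -> : (r.-1 < m)%N = false by lia.
  rewrite subr0 mulr1n /=.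
  case: (leqP n m) => nm.
    (* For [n <= m < r], the [r - m >= 1] entries past [m] are positive in [u] and nonpositive in
       [b], which gives the slack. *)
    apply: le_trans (bmono m _); last lia.
    rewrite beq !psum_int_to_real -intrD ler_int.
    by have := psumge m mr; lia.
  (* For [i < m < n] the partial sums of [u] are linear. Interpolating between slack at least zero
     at [i] and at least [n] at [n] gives at least [(m - i) n / (n - i) >= 1]. *)
  have conc := sorted_sum_concave bs (ltnW im) (ltnW nm) ltac:(lia).
  have Bn : psum n (int_to_real R u) + n%:R <= psum n b.
    apply: le_trans (bmono n _); last lia.
    rewrite beq !psum_int_to_real -[n%:R]/(n%:Z%:~R) -intrD ler_int.
    by have := psumge n ltac:(lia); lia.
  have Bi := bge i.
  rewrite psum_int_to_real (psumc n) in Bn; last lia.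
  rewrite psum_int_to_real in Bi.
  rewrite psum_int_to_real (psumc m); last lia.
  move: conc Bi Bn; rewrite !intrD !rmorphMn /=.
  rewrite -[(_ - _) *+ (m - i)]mulr_natr -[(_ - _) *+ (n - i)]mulr_natr.
  rewrite -[_%:~R *+ (n - i)]mulr_natr -[_%:~R *+ (m - i)]mulr_natr.
  set p := (m - i)%:R; set q := (n - i)%:R.
  set B0 := psum i b; set B1 := psum m b; set B2 := psum n b.
  set c := (u@_i)%:~R; set U := (psum i u)%:~R => conc Bi Bn.
  have p1 : 1 <= p :> R by rewrite ler1n; lia.
  have pq : p < q :> R by rewrite ltr_nat; lia.
  have qn : q <= n%:R :> R by rewrite ler_nat; lia.
  rewrite -(@ler_pM2r _ q); last by lra.
  have h1 : p * (U + c * q + n%:R) <= p * B2 by rewrite ler_wpM2l //; lra.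
  have h2 : (q - p) * U <= (q - p) * B0 by rewrite ler_wpM2l //; lra.
  have h3 : q <= p * n%:R by nra.
  nra.
- rewrite psum_shift; have -> : (r.-1 < r)%N by lia.
  have -> : (i < r)%N by lia.
  by rewrite addrK beq.
Qed.

Definition few_pos m (u : {malg int[nat]}) :=
  exists2 t : seq nat, (size t <= m)%N & forall k, k \notin t -> u@_k <= 0.

(** Sorting [u] reduces this to [cone_spread_sorted], with [r] the number of positive entries; the
    alternative is invariant under swaps, as the indices can be renamed. *)
Lemma cone_spread (u : {malg int[nat]}) : cone O (int_to_real R u) ->
  few_pos n.*2 u \/ exists i j,
    [/\ i != j, 0 < u@_j <= u@_i & cone O (int_to_real R (shift 1 j i u))].
Proof.
pose Q u := few_pos n.*2 u \/ exists i j,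
    [/\ i != j, 0 < u@_j <= u@_i & cone O (int_to_real R (shift 1 j i u))].
rewrite -/(Q u) => Cu.
have sC r := cone_swap_closed (@sO r).
have sQ a c w : Q (sym_act (swap a c) w) -> Q w.
  case=> [[t tn t0]|[i [j [ij uij Cij]]]].
    left; exists [seq swap a c k | k <- t]; first by rewrite size_map.
    move=> k kt; rewrite -(swapK a c k) -mcoeff_swap t0 //.
    by apply: contraNN kt => kt; rewrite -(swapK a c k) map_f.
  right; exists (swap a c i), (swap a c j); rewrite !mcoeff_swap in uij.
  rewrite (inj_eq (can_inj (swapK a c))); split=> //.
  rewrite -[w](sym_act_swapK a c) -sym_act_shift int_to_real_sym_act; last exact: Sym_swap.
  by apply: (sC (a + c).+1) => //; lia.
(* Membership in [D] remembers how to get back from the sorted vector to [u]. *)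
pose D := [set w | cone O (int_to_real R w) /\ (Q w -> Q u)].
have sD r : swap_closed r D.
  move=> i j w ir jr [Cw wu]; split; last by move=> /sQ.
  by rewrite int_to_real_sym_act; [apply: sC ir jr _ | apply: Sym_swap].
have [N uN] := malg_bound u.
have [w [[Cw wu] ws wE _ _]] := @sort_mem _ N D u (@sD N) (conj Cu id).
apply: wu.
have exr : exists r, w@_r <= 0 by exists N; rewrite wE // uN.
case: (ex_minnP exr) => r wr rmin.
have rN : (r <= N)%N by apply: rmin; rewrite wE // uN.
have wpos k : (k < r)%N -> 0 < w@_k.
  by move=> kr; rewrite ltNge; apply/negP => /rmin; lia.
case: (leqP n.*2 r) => nr.
  have [|i lti Ci] := cone_spread_sorted Cw _ wpos nr.
    by move=> k kr; apply: ws; lia.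
  right; exists i, r.-1; split=> //; first lia.
  by rewrite wpos ?(sorted_upto_le ws) //; lia.
left; exists (iota 0 r); first by rewrite size_iota ltnW.
move=> k; rewrite mem_iota /= add0n -leqNgt => rk.
case: (ltnP k N) => kN; last by rewrite wE // uN.
exact: le_trans (sorted_upto_le ws rk kN) wr.
Qed.

End Cones.

(** * Bounded generators of the lattice points *)

Lemma finite_set_uniform (T : choiceType) (A : set T) (Q : T -> nat -> Prop) :
    finite_set A -> (forall x m p, (m <= p)%N -> Q x m -> Q x p) ->
    (forall x, A x -> exists m, Q x m) ->
  exists m, forall x, A x -> Q x m.
Proof.
move=> /finite_seqP[s ->] Qmono; elim: s => [_|x s IH sQ]; first by exists 0%N.
have [|m mQ] := IH; first by move=> y ys; apply: sQ; rewrite /= inE ys orbT.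
have [|p xQ] := sQ x; first by rewrite /= mem_head.
exists (maxn m p) => y /=; rewrite inE => /orP[/eqP ->|ys].
  exact: Qmono (leq_maxr _ _) xQ.
exact: Qmono (leq_maxl _ _) (mQ y ys).
Qed.

Definition int_box L K : set {malg int[nat]} :=
  [set w | forall k, ((L <= k)%N -> w@_k = 0) /\ (`|w@_k|%N <= K)%N].

Lemma finite_int_box L K : finite_set (int_box L K).
Proof.
pose f (h : {ffun 'I_L -> 'I_(K.*2.+1)}) : {malg int[nat]} :=
  \sum_(k < L) << ((h k)%:Z - K%:Z) *g (k : nat) >>.
apply: (@sub_finite_set _ _ (f @` setT)); last first.
  exact/finite_image/finite_finset.
move=> w wb; exists [ffun k : 'I_L => inord `|(w@_(k : nat) + K%:Z)%R|%N] => //.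
apply/malgP => m; rewrite /f raddf_sum /=.
have [mL|Lm] := ltnP m L; last first.
  rewrite (proj1 (wb m) Lm) big1 // => k _; rewrite mcoeffU.
  by have -> : (k == m :> nat) = false by have := ltn_ord k; lia.
rewrite (bigD1 (Ordinal mL)) //= big1 ?addr0 => [|k km]; last first.
  by rewrite mcoeffU; move: km; rewrite -val_eqE /= => /negbTE ->.
rewrite mcoeffUU ffunE /= inordK; have [_] := wb m; move: (w@_m : int) => z; lia.
Qed.

(** A bound on the l1-norm; ranging over all duplicate-free lists makes it easy to permute and
    independent of the support. *)
Definition norm_le K (w : {malg int[nat]}) :=
  forall s : seq nat, uniq s -> (\sum_(k <- s) `|w@_k| <= K)%N.

Lemma norm_le_mono w K K' : (K <= K')%N -> norm_le K w -> norm_le K' w.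
Proof. by move=> KK' wK s us; apply: leq_trans KK'; apply: wK. Qed.

Lemma sub_leq_sum (f : nat -> nat) (s s' : seq nat) : uniq s -> uniq s' ->
  {subset s <= s'} -> (\sum_(k <- s) f k <= \sum_(k <- s') f k)%N.
Proof. by move=> *; apply: (uniq_sub_le_big leqnn (fun m p => leq_addr p m)). Qed.

Lemma norm_le_exists w : exists K, norm_le K w.
Proof.
exists (\sum_(k <- msupp w) `|w@_k|)%N => s us.
rewrite (bigID (fun k => k \in msupp w)) /= [X in (_ + X)%N]big1 ?addn0; last first.
  by move=> k /mcoeff_outdom ->.
rewrite -big_filter; apply: sub_leq_sum; rewrite ?filter_uniq ?fset_uniq //.
by move=> k; rewrite mem_filter => /andP[].
Qed.

Lemma norm_le_sym_act K s w : Sym s -> norm_le K w -> norm_le K (sym_act s w).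
Proof.
move=> [[t st ts] _] wK l ul.
rewrite (eq_bigr (fun k => `|w@_(t k)|%N)) => [|k _]; last first.
  by rewrite (mcoeff_sym_act_can _ _ st ts).
have := wK (map t l); rewrite big_map; apply.
by rewrite map_inj_uniq //; apply: can_inj ts.
Qed.

Lemma norm_le_coef K w k : norm_le K w -> (`|w@_k| <= K)%N.
Proof. by move=> /(_ [:: k] isT); rewrite big_seq1. Qed.

Lemma norm_le_supp K w : norm_le K w -> supp_le K w.
Proof.
move=> wK; exists (msupp w : seq nat); last by move=> k; apply: mcoeff_outdom.
apply: leq_trans (wK (msupp w : seq nat) (fset_uniq _)).
rewrite -sum1_size big_seq [leqRHS]big_seq; apply: leq_sum => k.
by rewrite absz_gt0 mcoeff_neq0.
Qed.

(** Only the terms at [a] and [b] change; the old ones are added on the left because subtraction of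
    naturals truncates. Used for absolute values and for squares. *)
Lemma sum_seq_shift (f : int -> nat) (s : seq nat) d (a b : nat) (w : {malg int[nat]}) :
    uniq s -> a \in s -> b \in s -> a != b ->
  (\sum_(k <- s) f (shift d a b w)@_k + (f w@_a + f w@_b) =
   \sum_(k <- s) f w@_k + (f (w@_a - d)%R + f (w@_b + d)%R))%N.
Proof.
move=> us sa sb ab.
rewrite !(bigD1_seq a) //= -!(big_filter s) !(bigD1_seq b) ?filter_uniq //=;
  try by rewrite mem_filter sb eq_sym ab.
rewrite !mcoeff_shift !eqxx [b == a]eq_sym (negbTE ab) !mulr0n !mulr1n subr0 addr0.
set S := (X in (_ + (_ + X) + _ = _)%N); set S' := (X in (_ + _ = _ + (_ + X) + _)%N).
have -> : S = S'; last first.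
  by move: S' (f w@_a) (f w@_b) (f (w@_a - d)%R) (f (w@_b + d)%R); lia.
rewrite /S /S' big_seq_cond [RHS]big_seq_cond; apply: eq_bigr => k.
rewrite mem_filter => /andP[/andP[ka _] kb]; rewrite mcoeff_shift.
by rewrite ![_ == k]eq_sym (negbTE ka) (negbTE kb) mulr0n addr0 subr0.
Qed.

(** For integers, [y < x] implies [|x - 1| + |y + 1| <= |x| + |y|]; the list is first enlarged to
    contain both indices. *)
Lemma norm_le_shift K w a b : w@_b < w@_a -> norm_le K w ->
  norm_le K (shift 1 a b w).
Proof.
move=> wab wK s us; pose s' := undup [:: a, b & s].
have us' : uniq s' by apply: undup_uniq.
apply: (@leq_trans (\sum_(k <- s') `|(shift 1 a b w)@_k|)%N).
  by apply: sub_leq_sum => // k ks; rewrite mem_undup !inE ks !orbT.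
apply: leq_trans (wK s' us').
have ab : a != b by apply: contraTneq wab => ->; rewrite ltxx.
have := @sum_seq_shift (fun z : int => `|z|%N) s' 1 a b w us'.
rewrite !mem_undup !inE !eqxx !orbT ab => /(_ isT isT isT).
move=> sumE; rewrite -(leq_add2r (`|w@_a| + `|w@_b|)%N) sumE leq_add2l.
by move: wab; move: (w@_a : int) (w@_b : int) => x y; lia.
Qed.

Lemma monoid_span_ind (A : set {malg int[nat]}) (P : {malg int[nat]} -> Prop) :
    P 0 -> (forall u g, P u -> A g -> P (u + g)) ->
  forall u, monoid_span A u -> P u.
Proof.
move=> P0 PS u [m [c [v [vA ->]]]].
suff: forall x, P x -> P (x + \sum_(i < m) v i *+ c i) by move=> /(_ 0 P0); rewrite add0r.
apply: (big_ind (fun y => forall x, P x -> P (x + y))) => [x|y z Py Pz x Px|i _ x].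
- by rewrite addr0.
- by rewrite addrA; apply/Pz/Py.
- elim: (c i) => [|l IH] Px; first by rewrite mulr0n addr0.
  by rewrite mulrSr addrA; apply: PS => //; apply: IH.
Qed.

Lemma monoid_span0 A : monoid_span A 0.
Proof. by exists 0%N, (fun _ => 0%N), (fun _ => 0); split; [case | rewrite big_ord0]. Qed.

Lemma monoid_spanD A u v : monoid_span A u -> monoid_span A v -> monoid_span A (u + v).
Proof.
move=> [m [c [x [xA ->]]]] [p [d [y [yA ->]]]].
exists (m + p)%N, (fun i => match fintype.split i with inl j => c j | inr j => d j end).
exists (fun i => match fintype.split i with inl j => x j | inr j => y j end).
split=> [i|]; first by case: (fintype.split i).
rewrite big_split_ord; apply: f_equal2; apply: eq_bigr => i _ /=.
  by rewrite (unsplitK (inl i)).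
by rewrite (unsplitK (inr i)).
Qed.

Lemma subset_monoid_span A : A `<=` monoid_span A.
Proof.
move=> u Au; exists 1%N, (fun _ => 1%N), (fun _ => u).
by split=> //; rewrite big_ord1 mulr1n.
Qed.

Lemma Sym_id : Sym id.
Proof.
split; first by exists id.
by rewrite (_ : [set i | id i <> i] = set0) //; apply/seteqP; split=> i.
Qed.

Lemma sym_orbit_act (G : zmodType) (A : set {malg G[nat]}) s x : Sym s ->
  sym_orbit A x -> sym_orbit A (sym_act s x).
Proof.
move=> Ss [t [a [St Aa ->]]]; exists (s \o t), a.
by split=> //; [apply: Sym_comp | rewrite sym_act_comp].
Qed.

Section BoundedGenerators.
Variables (M : set {malg int[nat]}) (K : nat).
Hypothesis M_sym_act : forall s u, Sym s -> M u -> M (sym_act s u).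
Hypothesis M_shift : forall a b u, M u -> u@_b < u@_a -> M (shift 1 a b u).

(** The support condition makes the set finite; by [norm_le_span] its orbit still generates all of
    [M] of l1-norm at most [K]. *)
Definition bounded_part : set {malg int[nat]} :=
  [set w | [/\ M w, norm_le K w & forall k, (K <= k)%N -> w@_k = 0]].

Local Notation N := (monoid_span (sym_orbit bounded_part)).

Lemma finite_bounded_part : finite_set bounded_part.
Proof.
apply: sub_finite_set (@finite_int_box K K) => w [_ wK w0] k.
by split; [apply: w0 | apply: norm_le_coef].
Qed.

Lemma span_sym_act s u : Sym s -> N u -> N (sym_act s u).
Proof.
move=> Ss; move: u; apply: monoid_span_ind => [|u g Nu Bg].
  by rewrite /sym_act msupp0 big_nil; apply: monoid_span0.
rewrite sym_actD //; apply: monoid_spanD => //.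
by apply/subset_monoid_span/sym_orbit_act.
Qed.

(** An integer vector of l1-norm at most [K] has at most [K] nonzero entries, hence can be permuted
    into the first [K] coordinates. *)
Lemma norm_le_span w : M w -> norm_le K w -> N w.
Proof.
move=> Mw wK; pose D := [set z | [/\ M z, norm_le K z & N z -> N w]].
have sD r : swap_closed r D.
  move=> i j z _ _ [Mz zK zw]; split.
  - by apply: M_sym_act (Sym_swap i j) Mz.
  - by apply: norm_le_sym_act (Sym_swap i j) zK.
  - move=> Nz; apply: zw; rewrite -(sym_act_swapK i j z).
    exact: span_sym_act (Sym_swap i j) Nz.
have Dw : D w by split.
have [z [Mz zK zw] zE] := supp_to_window 0 pred0 sD Dw (norm_le_supp wK).
apply/zw/subset_monoid_span; exists id, z; split; [exact: Sym_id | | by rewrite sym_act_id].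
by split=> // k Kk; rewrite zE //; lia.
Qed.

(* A strict inequality between two coordinates of a sum holds already in one of
   the summands, which can absorb the transfer. *)
Lemma span_shift a b u : N u -> u@_b < u@_a -> N (shift 1 a b u).
Proof.
move=> Nu; suff [] : N u /\ (u@_b < u@_a -> N (shift 1 a b u)) by [].
move: u Nu; apply: monoid_span_ind => [|u g [Nu IH] Bg].
  by split; [apply: monoid_span0 | rewrite !mcoeff0 ltxx].
have Ng : N g by apply: subset_monoid_span.
split; first exact: monoid_spanD.
rewrite !mcoeffD => ugab; have [uab|uab] := ltP u@_b u@_a.
  rewrite (_ : shift _ _ _ _ = shift 1 a b u + g); first exact/monoid_spanD/Ng/IH.
  by rewrite /shift [u + g + _]addrAC [_ + g - _]addrAC.
have gab : g@_b < g@_a.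
  by rewrite ltNge; apply: contraTN ugab => gab; rewrite -leNgt lerD.
rewrite (_ : shift _ _ _ _ = u + shift 1 a b g); last by rewrite /shift !addrA.
apply: monoid_spanD => //.
case: Bg gab => s [h [Ss [Mh hK _] ->]] gab; apply: norm_le_span.
  by apply: M_shift => //; apply: M_sym_act.
by apply: norm_le_shift => //; apply: norm_le_sym_act.
Qed.

End BoundedGenerators.

(** * Lattice points of a symmetric cone *)

Section LatticePoints.
Variable R : realType.

Lemma lattice_points_sym_act (O : set {malg R[nat]}) s u : Sym s ->
    (forall x, O x -> O (sym_act s x)) ->
  lattice_points (cone O) u -> lattice_points (cone O) (sym_act s u).
Proof.
by move=> Ss sO Cu; rewrite /lattice_points /= int_to_real_sym_act //; apply: cone_sym_act.
Qed.

Lemma lattice_points_shift (O : set {malg R[nat]}) a b u :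
    (forall r, swap_closed r O) ->
  lattice_points (cone O) u -> u@_b < u@_a -> lattice_points (cone O) (shift 1 a b u).
Proof.
move=> sO Cu uab; rewrite /lattice_points /= int_to_real_shift.
apply: (shift_mem (r := (a + b).+1)) => //; try lia.
- exact: cone_swap_closed.
- exact: cone_convex.
- by rewrite !mcoeff_int_to_real ler01 -intrB ler1z lerBrDl lezD1.
Qed.

Lemma cone_seq (s : seq {malg int[nat]}) x :
    uniq s -> cone [set int_to_real R g | g in [set` s]] x ->
  exists2 c : {malg int[nat]} -> R, forall g, 0 <= c g &
    x = \sum_(g <- s) c g *: int_to_real R g.
Proof.
move=> us; move: x; apply: cone_ind => [|x y [c c0 ->] [d d0 ->]|a _ a0 [g gs <-]].
- exists (fun _ => 0) => //.
  by rewrite big1 // => g _; rewrite scale0r.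
- exists (fun g => c g + d g) => [g|]; first exact: addr_ge0.
  by rewrite -big_split /=; apply: eq_bigr => g _; rewrite scalerDl.
- exists (fun h => if h == g then a else 0) => [h|]; first by case: ifP.
  rewrite (bigD1_seq g) //= eqxx big1 ?addr0 // => h /negbTE ->.
  by rewrite scale0r.
Qed.

(** Gordan's argument: without their integral parts the coefficients lie in [[0, 1]], so the
    remainder stays in the cone and its l1-norm is at most the sum of those of the generators. *)
Lemma lattice_points_fractional_part (s : seq {malg int[nat]}) K u : uniq s ->
    (forall g, g \in s -> norm_le K g) ->
    cone [set int_to_real R g | g in [set` s]] (int_to_real R u) ->
  exists v f, [/\ u = v + \sum_(g <- s) g *+ f g, norm_le (size s * K) v &
    cone [set int_to_real R g | g in [set` s]] (int_to_real R v)].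
Proof.
move=> us sK /cone_seq [] // c c0 uE.
pose f g := Num.truncn (c g).
have fc g : 0 <= c g - (f g)%:R <= 1.
  by have := truncn_itv (c0 g); rewrite -/(f g) -natr1 => /andP[? ?]; apply/andP; split; lra.
pose v := u - \sum_(g <- s) g *+ f g.
have vE : int_to_real R v = \sum_(g <- s) (c g - (f g)%:R) *: int_to_real R g.
  rewrite /v int_to_realD int_to_realN uE.
  rewrite (big_morph _ (@int_to_realD R) (@int_to_real0 R)) -sumrB.
  by apply: eq_bigr => g _; rewrite int_to_realMn scalerBl.
exists v, f; split; first by rewrite subrK.
  move=> l ul; apply: (@leq_trans (\sum_(k <- l) \sum_(g <- s) `|g@_k|)%N).
    apply: leq_sum => k _; rewrite -(ler_nat R) natr_absz.
    rewrite intr_norm -mcoeff_int_to_real vE raddf_sum natr_sum /=.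
    apply: le_trans (ler_norm_sum _ _ _) _; apply: ler_sum => g _.
    rewrite natr_absz intr_norm mcoeffZ mcoeff_int_to_real normrM.
    have /andP[fc0 fc1] := fc g.
    by rewrite ler_piMl // ger0_norm.
  rewrite exchange_big /= -sum1_size big_distrl /= big_seq [leqRHS]big_seq.
  by apply: leq_sum => g gs; rewrite mul1n sK.
rewrite vE big_seq.
apply: (big_ind (cone [set int_to_real R g | g in [set` s]])).
- exact: cone0.
- by move=> x y; apply: coneD.
- move=> g gs; apply: coneZ; first by case/andP: (fc g).
  by apply: subset_cone; exists g.
Qed.

Variables (O : set {malg R[nat]}) (n : nat).
Hypothesis n_gt0 : (0 < n)%N.
Hypothesis sO : forall s x, Sym s -> O x -> O (sym_act s x).
Hypothesis nO : forall x, O x -> supp_le n x.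

Local Notation M := (lattice_points (cone O)).

(** [cone_spread] is applied to [u], and to [-u] in the cone over the negated generators. If neither
    yields a transfer, at most [2n] entries are positive and at most [2n] negative. *)
Lemma lattice_points_spread u : M u -> supp_le n.*2.*2 u \/
  exists a b, [/\ a != b, M (shift 1 a b u), u@_a <= u@_b & (0 < u@_a) || (u@_b < 0)].
Proof.
move=> Mu.
have swO r : swap_closed r O by move=> i j x _ _; apply/sO/Sym_swap.
pose O' := [set - x | x in O].
have swO' r : swap_closed r O'.
  move=> i j _ _ _ [x Ox <-]; exists (sym_act (swap i j) x); first exact/sO/Ox/Sym_swap.
  by rewrite sym_actN //; apply: Sym_swap.
have nO' x : O' x -> supp_le n x.
  by move=> [y /nO[t tn t0] <-]; exists t => // k /t0; rewrite mcoeffN => ->; rewrite oppr0.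
have MuN : cone O' (int_to_real R (- u)) by rewrite int_to_realN; apply: cone_oppr.
have [[t1 n1 t1P]|[i [j [ij /andP[uj uij] Mij]]]] := cone_spread n_gt0 swO nO Mu; last first.
  by right; exists j, i; split; rewrite ?uj // eq_sym.
have [[t2 n2 t2P]|[i [j [ij]]]] := cone_spread n_gt0 swO' nO' MuN; last first.
  rewrite !mcoeffN oppr_gt0 lerN2 => /andP[uj uij] Mij.
  right; exists i, j; split; rewrite ?uj ?orbT //.
  rewrite /lattice_points /= -[int_to_real R _]opprK -int_to_realN.
  have -> : - shift 1 i j u = shift 1 j i (- u).
    by rewrite /shift !opprD opprK addrAC.
  have O'K : [set - x | x in O'] = O.
    apply/seteqP; split=> [_ [_ [x Ox <-] <-]|x Ox]; first by rewrite opprK.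
    by exists (- x); [exists x | rewrite opprK].
  by rewrite -[in cone O _]O'K; apply: cone_oppr.
left; exists (t1 ++ t2); first by rewrite size_cat -[n.*2.*2]addnn leq_add.
move=> k; rewrite mem_cat negb_or => /andP[/t1P u1 /t2P].
by rewrite mcoeffN oppr_le0 => u2; apply/eqP; rewrite eq_le u1.
Qed.

Variable K : nat.

Local Notation N := (monoid_span (sym_orbit (bounded_part M K))).

Lemma lattice_points_span :
    (forall u, M u -> (forall k, ~~ (n <= k < n + n.*2.*2)%N -> u@_k = 0) -> N u) ->
  forall u, M u -> N u.
Proof.
move=> hN.
have Msym s u : Sym s -> M u -> M (sym_act s u).
  by move=> Ss; apply: lattice_points_sym_act => // x; apply: sO.
have Mshift a b u : M u -> u@_b < u@_a -> M (shift 1 a b u).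
  by apply: lattice_points_shift => r i j x _ _; apply/sO/Sym_swap.
have small u : M u -> supp_le n.*2.*2 u -> N u.
  (* The window starts at [n], keeping the first [n] coordinates free as the room for
     [cone_window]. *)
  move=> Mu nu; pose D := [set z | M z /\ (N z -> N u)].
  have sD r : swap_closed r D.
    move=> i j z _ _ [Mz zu]; split; first exact: Msym (Sym_swap i j) Mz.
    move=> Nz; apply: zu; rewrite -(sym_act_swapK i j z).
    exact: span_sym_act (Sym_swap i j) Nz.
  have [z [Mz zu] z0] := supp_to_window n pred0 sD (conj Mu id) nu.
  by apply/zu/hN.
move=> u0 Mu0; have [m u0m] := malg_bound u0.
pose T := (\sum_(k <- iota 0 m) `|u0@_k|)%N.
(* Vectors of l1-norm [T] have sum of squares at most [T * T], so [d] bounds how far that sum can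
   still grow. *)
suff main d u : (forall k, (m <= k)%N -> u@_k = 0) -> M u ->
    (\sum_(k <- iota 0 m) `|u@_k| = T)%N ->
    (T * T < d + \sum_(k <- iota 0 m) `|u@_k| * `|u@_k|)%N -> N u.
  by apply: (main (T * T).+1) => //; rewrite addSn ltnS leq_addr.
elim: d u => [|d IH] u um Mu uT ud.
  have : (\sum_(k <- iota 0 m) `|u@_k| * `|u@_k| <= T * T)%N.
    rewrite -{1}uT big_distrl /= big_seq [leqRHS]big_seq; apply: leq_sum => k km.
    rewrite leq_mul2l; apply/orP; right; rewrite -uT.
    by rewrite (bigD1_seq k) ?iota_uniq //= leq_addr.
  by rewrite leqNgt; move: ud; rewrite add0n => ->.
have [/(small _ Mu) //|[a [b [ab Mab uab pos]]]] := lattice_points_spread Mu.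
(* Entries beyond [m] are zero, which the sign condition and [u_a <= u_b] exclude at both [a] and
   [b]. *)
have am : a \in iota 0 m.
  rewrite mem_iota /= add0n ltnNge; apply/negP => /um ua; move: uab pos.
  by rewrite ua ltxx /= => ub; rewrite ltNge ub.
have bm : b \in iota 0 m.
  rewrite mem_iota /= add0n ltnNge; apply/negP => /um ub; move: uab pos.
  by rewrite ub ltxx orbF => ua; rewrite ltNge ua.
pose v := shift 1 a b u.
have va : v@_a = u@_a - 1.
  by rewrite mcoeff_shift eqxx eq_sym (negbTE ab) mulr0n addr0.
have vb : v@_b = u@_b + 1.
  by rewrite mcoeff_shift eqxx (negbTE ab) mulr0n subr0.
have uE : u = shift 1 b a v by rewrite /v /shift [_ - _ + _]subrK addrK.
(* [v] is in [N] by induction, and [u] is a unit transfer of it, from [b] back to [a]. *)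
rewrite uE; apply: span_shift => //; last first.
  by rewrite va vb; move: uab; move: (u@_a : int) (u@_b : int) => x y; lia.
apply: IH => //.
- move=> k mk; rewrite mcoeff_shift um //.
  have -> : (b == k) = false by move: bm; rewrite mem_iota; lia.
  have -> : (a == k) = false by move: am; rewrite mem_iota; lia.
  by rewrite mulr0n addr0 subr0.
- have := sum_seq_shift (fun z => `|z|%N) 1 u (iota_uniq 0 m) am bm ab.
  (* Both entries have the same sign and neither crosses zero. *)
  have -> : (`|(u@_a - 1)%R| + `|(u@_b + 1)%R| = `|u@_a| + `|u@_b|)%N.
    by move: uab pos; move: (u@_a : int) (u@_b : int) => x y; lia.
  by rewrite uT => /addIn.
- have := sum_seq_shift (fun z => `|z| * `|z|)%N 1 u (iota_uniq 0 m) am bm ab.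
  (* The sum of squares gains [2 (u_b - u_a) + 2 > 0]. *)
  have : (`|u@_a| * `|u@_a| + `|u@_b| * `|u@_b| <
      `|(u@_a - 1)%R| * `|(u@_a - 1)%R| + `|(u@_b + 1)%R| * `|(u@_b + 1)%R|)%N.
    by move: uab pos; move: (u@_a : int) (u@_b : int) => x y; nia.
  move: ud; rewrite -/v /=.
  set S1 := (\sum_(k <- _) (_ * _))%N => uT1 AB E.
  rewrite -(ltn_add2r (`|u@_a| * `|u@_a| + `|u@_b| * `|u@_b|)) -addnA E [ltnRHS]addnA.
  by rewrite -addnS leq_add // -ltnS -addSn.
Qed.

End LatticePoints.

(** * Finite generation and the theorem *)

Lemma monoid_span_sum (B : set {malg int[nat]}) (s : seq {malg int[nat]}) f :
  (forall g, g \in s -> monoid_span B g) -> monoid_span B (\sum_(g <- s) g *+ f g).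
Proof.
move=> sB; rewrite big_seq; apply: (big_ind (monoid_span B)) => [|u v|g gs].
- exact: monoid_span0.
- exact: monoid_spanD.
- elim: (f g) => [|l IH]; first by rewrite mulr0n; apply: monoid_span0.
  by rewrite mulrSr; apply: monoid_spanD (sB g gs).
Qed.

Lemma sym_orbit_int_box m (A : set {malg int[nat]}) g : A `<=` int_box m m ->
  sym_orbit A g -> supp_le m g /\ forall k, (`|g@_k| <= m)%N.
Proof.
move=> Am [s [a [[[t st ts] _] /Am am ->]]]; split=> [|k]; last first.
  by rewrite (mcoeff_sym_act_can _ _ st ts); have [] := am (t k).
exists (map s (iota 0 m)); first by rewrite size_map size_iota.
move=> k km; rewrite (mcoeff_sym_act_can _ _ st ts); have [am0 _] := am (t k).
apply: am0; rewrite leqNgt; apply: contraNN km => km.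
by apply/mapP; exists (t k); rewrite // mem_iota.
Qed.

Lemma sym_fg_lattice_points (R : realType) (A : set {malg int[nat]}) :
  finite_set A -> sym_fg_monoid (lattice_points (cone (sym_orbit (int_to_real R @` A)))).
Proof.
move=> finA; set O := sym_orbit _; set M := lattice_points _.
have [m Am] : exists m, A `<=` int_box m m.
  apply: (finite_set_uniform (Q := fun a m => int_box m m a)) => // [a m p mp am k|a _].
    have [a0 ak] := am k; split; last exact: leq_trans mp.
    by move=> pk; apply/a0/(leq_trans mp).
  have [[m ma] [p ap]] := (malg_bound a, norm_le_exists a).
  exists (maxn m p) => k; split; first by rewrite geq_max => /andP[mk _]; apply: ma.
  by apply: leq_trans (leq_maxr _ _); apply: norm_le_coef.
have OE y : O y -> exists2 g, sym_orbit A g & y = int_to_real R g.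
  move=> [s [_ [Ss [a Aa <-] ->]]]; exists (sym_act s a); first by exists s, a.
  by rewrite int_to_real_sym_act.
have sO s x : Sym s -> O x -> O (sym_act s x) by apply: sym_orbit_act.
have swO r : swap_closed r O by move=> i j x _ _; apply/sO/Sym_swap.
(* [m + 1] rather than [m] ensures that [n] is positive. *)
pose n := m.+1; have nO x : O x -> supp_le n x.
  move=> /OE[g /(sym_orbit_int_box Am)[[t tm t0] _] ->].
  exists t; first exact: leqW.
  by move=> k /t0 gk; rewrite mcoeff_int_to_real gk.
(* The first [n] coordinates are room for averaging; the next [4n] hold the vectors left over by
   [lattice_points_span]. *)
pose L := (n + n.*2.*2)%N.
pose G := [set g | sym_orbit A g /\ forall k, (L <= k)%N -> g@_k = 0].
have finG : finite_set G.
  apply: sub_finite_set (@finite_int_box L m) => g [/(sym_orbit_int_box Am)[_ gm] gL] k.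
  by split; [apply: gL | apply: gm].
have [K GK] : exists K, forall g, G g -> norm_le K g.
  by apply: finite_set_uniform => // [g p q|g _]; [apply: norm_le_mono | apply: norm_le_exists].
have [s Gs] := (finite_seqP G).1 finG.
have us := undup_uniq s.
have sG g : (g \in undup s) -> G g by rewrite Gs /= mem_undup.
(* This is the norm bound for the remainder in Gordan's argument. *)
pose B := bounded_part M (size (undup s) * K).
exists B; split; first exact: finite_bounded_part.
have Msym t u : Sym t -> M u -> M (sym_act t u).
  by move=> St; apply: lattice_points_sym_act => // x; apply: sO.
have MG g : G g -> M g.
  move=> [[t [a [St Aa ->]]] _]; rewrite /M /lattice_points /= int_to_real_sym_act //.
  by apply: subset_cone; exists t, (int_to_real R a); split=> //; exists a.
have inN := norm_le_span Msym.
apply/seteqP; split=> u; last first.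
  apply: monoid_span_ind => [|v g Mv [t [h [St [Mh _ _] ->]]]].
    by rewrite /M /lattice_points /= int_to_real0; apply: cone0.
  by rewrite /M /lattice_points /= int_to_realD; apply: coneD => //; apply: Msym.
apply: (lattice_points_span _ sO nO) => // {}u Mu u0.
have : cone [set int_to_real R g | g in [set` undup s]] (int_to_real R u).
  have <- : [set y | O y /\ forall k, (L <= k)%N -> y@_k = 0] =
      [set int_to_real R g | g in [set` undup s]].
    apply/seteqP; split=> [_ [/OE[g Ag ->] gL]|_ [g /sG [[t [a [St Aa ->]]] gL] <-]].
      exists g => //=; rewrite mem_undup; suff: G g by rewrite Gs.
      split=> // k /gL /eqP; rewrite mcoeff_int_to_real intr_eq0 => /eqP //.
    split; last by move=> k /gL; rewrite mcoeff_int_to_real => ->.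
    by rewrite int_to_real_sym_act //; exists t, (int_to_real R a); split=> //; exists a.
  apply: (cone_window (n := n)) => //; first exact: leq_addr.
    by move=> k kn; rewrite mcoeff_int_to_real u0 //; lia.
  by move=> k kL; rewrite mcoeff_int_to_real u0 //; rewrite /L in kL; lia.
move=> /(lattice_points_fractional_part us (fun g gs => GK g (sG g gs))).
move=> [v [f [-> vK Cv]]]; apply: monoid_spanD.
  apply: inN vK; rewrite /M /lattice_points /=.
  move: Cv; move: (int_to_real R v).
  apply: cone_ind => [|x y|a _ a0 [g /sG /MG Mg <-]]; first exact: cone0.
    exact: coneD.
  exact: coneZ.
apply: monoid_span_sum => g gs; apply: inN; first exact/MG/sG.
apply: norm_le_mono (GK g (sG g gs)).
(* The list contains [g], so its size is at least one and [K] is within the bound. *)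
by rewrite leq_pmull // -has_predT; apply/hasP; exists g.
Qed.

Theorem theorem6p1 (R : realType) (C : set {malg R[nat]}) :
  sym_fg_rational_cone C ->
  [/\ is_monoid (lattice_points C),
      sym_fg_monoid (lattice_points C)
    & normal_monoid (lattice_points C)].
Proof.
move=> [A [finA ->]]; split.
- split=> [|u v]; rewrite /lattice_points /=.
    by rewrite int_to_real0; apply: cone0.
  by rewrite int_to_realD; apply: coneD.
- exact: sym_fg_lattice_points.
- move=> u k k0; rewrite /lattice_points /= int_to_realMn => Cku.
  have k_neq0 : k%:R != 0 :> R by rewrite pnatr_eq0 -lt0n.
  by rewrite -[int_to_real R u](scalerK k_neq0); apply: coneZ; rewrite // invr_ge0.
Qed.
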